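(* Let $\varphi$ be a nonincreasing probability density and $\psi$ a nondecreasing probability density on $[0,1]$. Let $$\Phi(x)=\int_0^x\varphi(s)\,ds,\qquad \Psi(x)=\int_0^x\psi(s)\,ds,$$ put $$H=\Phi-\Psi,\qquad A=\int_0^1H(x)\,dx,$$ and assume $A>0$. Define, for $x\in[0,1]$, $$p(x)=\frac{H(x)}A,\qquad q(x)=\frac{\varphi(x)+\psi(x)}2 .$$ Then $\mathcal D(q)\ge \mathcal D(p)$.
   Context: For a probability measure $\rho$ on $\mathbb R$, the Gini mean difference is $\mathcal D(\rho)=\iint_{\mathbb R^2}|x-y|\,d\rho(x)\,d\rho(y)$; for a probability density, $\mathcal D$ denotes the Gini mean difference of the corresponding probability measure. Since $\Phi$ is concave and $\Psi$ is convex on $[0,1]$, $H\ge 0$, so $p$ is a probability density on $[0,1]$. *)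

(* Defs.v *)
From HB Require Import structures.
From mathcomp Require Import all_boot all_order all_algebra.
From mathcomp Require Import all_classical all_reals all_analysis measurable_realfun.
From mathcomp Require Import ring lra.

Set Implicit Arguments.
Unset Strict Implicit.
Unset Printing Implicit Defensive.
Import Order.TTheory GRing.Theory Num.Theory.
Import numFieldNormedType.Exports.

Local Open Scope classical_set_scope.
Local Open Scope ring_scope.

Definition gini {R : realType} (rho : probability (measurableTypeR R) R)
    : \bar R :=
  (\int[rho \x rho]_z `|z.1 - z.2|%:E)%E.

(* Only the values of f on [0, 1] matter. *)
Definition density01 {R : realType} (f : R -> R) : Prop :=
  [/\ measurable_fun (`[0, 1] : set R) f,
      forall x : R, x \in `[0, 1] -> 0 <= f x
    & (\int[@lebesgue_measure R]_(x in `[0%R, 1%R]) (f x)%:E = 1)%E].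

(* Monotonicity is only asked on the open interval: the values at 0 and 1 are
   irrelevant to a density, and on the closed interval a real-valued monotone
   density would have to be bounded, which would exclude for instance
   x |-> 1 / (2 sqrt x). *)
Definition nonincreasing01 {R : realType} (f : R -> R) : Prop :=
  {in `]0, 1[ &, forall s t : R, s <= t -> f t <= f s}.

Definition nondecreasing01 {R : realType} (f : R -> R) : Prop :=
  {in `]0, 1[ &, forall s t : R, s <= t -> f s <= f t}.

Section density_prob.
Context {R : realType} (f : R -> R).
Local Notation mu := (@lebesgue_measure R).

(* The law on the real line with density f on [0, 1] and 0 elsewhere. *)
Definition density_prob (df : density01 f)
    : set (measurableTypeR R) -> \bar R :=
  fun U => (\int[mu]_(x in U `&` `[0%R, 1%R]) (f x)%:E)%E.

Hypothesis df : density01 f.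

Let density_prob0 : density_prob df set0 = 0%E.
Proof. by rewrite /density_prob set0I integral_set0. Qed.

Let density_prob_ge0 U : (0 <= density_prob df U)%E.
Proof.
by have [_ f0 _] := df; apply: integral_ge0 => x [_ /= x01]; rewrite lee_fin f0.
Qed.

Let density_prob_sigma_additive : semi_sigma_additive (density_prob df).
Proof.
have [mf f0 _] := df => F mF tF mUF; apply: cvg_toP.
  apply: ereal_nondecreasing_is_cvgn => m n mn.
  by apply: lee_sum_nneg_natr => // k _ _; exact: density_prob_ge0.
rewrite /density_prob setI_bigcupl ge0_integral_bigcup//=.
- by move=> k; exact: measurableI.
- apply/measurable_EFinP; apply: measurable_funS mf => //=.
  by move=> x [k _ []].
- by move=> x [k _ [_ /= x01]]; rewrite lee_fin f0.
- exact: trivIset_setIr.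
Qed.

HB.instance Definition _ := isMeasure.Build _ _ _ (density_prob df)
  density_prob0 density_prob_ge0 density_prob_sigma_additive.

Let density_prob_setT : density_prob df [set: _] = 1%E.
Proof. by rewrite /density_prob setTI; have [] := df. Qed.

HB.instance Definition _ := @Measure_isProbability.Build _ _ R
  (density_prob df) density_prob_setT.

End density_prob.

Section construction.
Context {R : realType}.
Implicit Types phi psi : R -> R.
Local Notation mu := (@lebesgue_measure R).

Definition cdf01 (f : R -> R) (x : R) : R := \int[mu]_(s in `[0, x]) f s.

(* The function H; its integral A over [0, 1] is gap_area. *)
Definition cdf_gap phi psi (x : R) : R := cdf01 phi x - cdf01 psi x.

Definition gap_area phi psi : R := \int[mu]_(x in `[0, 1]) cdf_gap phi psi x.

(* The density p; see gap_density01. *)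
Definition gap_density phi psi (x : R) : R :=
  cdf_gap phi psi x / gap_area phi psi.

(* The density q; see avg_density01. *)
Definition avg_density phi psi (x : R) : R := (phi x + psi x) / 2.

Lemma density01_integrable f : density01 f -> mu.-integrable `[0, 1] (EFin \o f).
Proof.
move=> [mf f0 f1]; apply/integrableP; split; first exact/measurable_EFinP.
under eq_integral => x x01.
  rewrite /= ger0_norm; last by apply: f0; rewrite inE/= in x01.
  over.
by rewrite f1 ltry.
Qed.

Lemma avg_density01 phi psi : density01 phi -> density01 psi ->
  density01 (avg_density phi psi).
Proof.
move=> dphi dpsi; have [mphi phi0 phi1] := dphi; have [mpsi psi0 psi1] := dpsi.
split.
- by apply: measurable_funM => //; exact: measurable_funD.
- by move=> x x01; rewrite divr_ge0// addr_ge0// ?phi0 ?psi0.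
- under eq_integral do rewrite /avg_density mulrC EFinM EFinD.
  rewrite ge0_integralZl//=; last 2 first.
  + by apply: emeasurable_funD; exact/measurable_EFinP.
  + by move=> x x01; rewrite -EFinD lee_fin addr_ge0// ?phi0 ?psi0.
  rewrite ge0_integralD//=; last 2 first.
  + exact/measurable_EFinP.
  + exact/measurable_EFinP.
  rewrite [X in (_ * (X + _))%E]phi1 [X in (_ * (_ + X))%E]psi1.
  by rewrite -EFinD -EFinM; congr EFin; field.
Qed.

Lemma cdf01_continuous f : density01 f -> {within `[0, 1], continuous (cdf01 f)}.
Proof.
by move=> df; apply: parameterized_integral_continuous => //; exact: density01_integrable.
Qed.

Lemma cdf01_1 f : density01 f -> cdf01 f 1 = 1.
Proof. by move=> [_ _ f1]; rewrite /cdf01 /Rintegral f1. Qed.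

Lemma cdf01_0 f : cdf01 f 0 = 0.
Proof. by rewrite /cdf01 set_itv1 Rintegral_set1. Qed.

Lemma cdf01_split f (x : R) : density01 f -> 0 < x < 1 ->
  cdf01 f x = \int[mu]_(s in `]0, x]) f s /\
  1 - cdf01 f x = \int[mu]_(s in `]x, 1[) f s.
Proof.
move=> df /andP[x0 x1]; have fi := density01_integrable df.
split.
  rewrite /cdf01 -Rintegral_itv_obnd_cbnd//.
  by apply: integrableS fi => //=; apply: subset_itv; rewrite bnd_simp// ?ltW.
rewrite -[X in X - _](cdf01_1 df) /cdf01 Rintegral_itvB//=; last 2 first.
  by rewrite bnd_simp ltW.
  by rewrite bnd_simp ltW.
rewrite -Rintegral_itv_bndo_bndc//.
by apply: integrableS fi => //=; apply: subset_itv; rewrite bnd_simp// ?ltW.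
Qed.

Lemma cst_Rintegral (c a b : R) (b0 b1 : bool) : a < b ->
  c * (b - a) =
  \int[mu]_(s in [set` Interval (BSide b0 a) (BSide b1 b)]) cst c s.
Proof.
by move=> ab; rewrite Rintegral_cst//= lebesgue_measure_itv/= lte_fin ab.
Qed.

Lemma cst_integrable (c a b : R) (b0 b1 : bool) :
  mu.-integrable [set` Interval (BSide b0 a) (BSide b1 b)] (EFin \o cst c).
Proof.
have ci : mu.-integrable `[a, b] (EFin \o cst c).
  by apply: continuous_compact_integrable; [exact: segment_compact|
    apply: continuous_subspaceT => x; exact: cst_continuous].
by apply: integrableS ci => //=; apply: subset_itv; [case: b0|case: b1];
  rewrite bnd_simp.
Qed.

Lemma nonincr_cdf01_ge phi (x : R) : density01 phi ->
  nonincreasing01 phi ->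
  0 < x < 1 -> x <= cdf01 phi x.
Proof.
move=> dphi mphi x01; have [e1 e2] := cdf01_split dphi x01.
have /andP[x0 x1] := x01; have fi := density01_integrable dphi.
have h1 : phi x * (x - 0) <= cdf01 phi x.
  rewrite e1 (cst_Rintegral _ false false)//.
  apply: le_Rintegral => //=.
  - exact: cst_integrable.
  - by apply: integrableS fi => //=; apply: subset_itv; rewrite bnd_simp// ?ltW.
  - move=> s; rewrite in_itv/= => /andP[s0 sx]; apply: mphi => //.
      by rewrite in_itv/= s0 (le_lt_trans sx).
have h2 : 1 - cdf01 phi x <= phi x * (1 - x).
  rewrite e2 (cst_Rintegral _ false true)//.
  apply: le_Rintegral => //=.
  - by apply: integrableS fi => //=; apply: subset_itv; rewrite bnd_simp// ?ltW.
  - exact: cst_integrable.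
  - move=> s; rewrite in_itv/= => /andP[xs s1]; apply: mphi => //; last exact: ltW.
      by rewrite in_itv/= s1 (lt_trans x0).
nra.
Qed.

Lemma nondecr_cdf01_le psi (x : R) : density01 psi ->
  nondecreasing01 psi ->
  0 < x < 1 -> cdf01 psi x <= x.
Proof.
move=> dpsi mpsi x01; have [e1 e2] := cdf01_split dpsi x01.
have /andP[x0 x1] := x01; have fi := density01_integrable dpsi.
have h1 : cdf01 psi x <= psi x * (x - 0).
  rewrite e1 (cst_Rintegral _ false false)//.
  apply: le_Rintegral => //=.
  - by apply: integrableS fi => //=; apply: subset_itv; rewrite bnd_simp// ?ltW.
  - exact: cst_integrable.
  - move=> s; rewrite in_itv/= => /andP[s0 sx]; apply: mpsi => //.
      by rewrite in_itv/= s0 (le_lt_trans sx).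
have h2 : psi x * (1 - x) <= 1 - cdf01 psi x.
  rewrite e2 (cst_Rintegral _ false true)//.
  apply: le_Rintegral => //=.
  - exact: cst_integrable.
  - by apply: integrableS fi => //=; apply: subset_itv; rewrite bnd_simp// ?ltW.
  - move=> s; rewrite in_itv/= => /andP[xs s1]; apply: mpsi => //; last exact: ltW.
      by rewrite in_itv/= s1 (lt_trans x0).
nra.
Qed.

Lemma gap_density01 phi psi : density01 phi -> density01 psi ->
  nonincreasing01 phi ->
  nondecreasing01 psi ->
  0 < gap_area phi psi -> density01 (gap_density phi psi).
Proof.
move=> dphi dpsi mphi mpsi A0.
have Hint : mu.-integrable `[0, 1] (EFin \o cdf_gap phi psi).
  apply: continuous_compact_integrable; first exact: segment_compact.
  move=> x; apply: continuousB; [exact: cdf01_continuous dphi x|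
    exact: cdf01_continuous dpsi x].
have mH : measurable_fun (`[0, 1] : set R) (cdf_gap phi psi).
  by apply/measurable_EFinP; exact: measurable_int Hint.
split.
- exact: measurable_funM.
- move=> x; rewrite in_itv/= => /andP[x0 x1].
  rewrite divr_ge0 ?(ltW A0)// /cdf_gap subr_ge0.
  have [->|xn0] := eqVneq x 0; first by rewrite !cdf01_0.
  have [->|xn1] := eqVneq x 1; first by rewrite !cdf01_1.
  have x01 : 0 < x < 1 by rewrite !lt_neqAle x0 x1 xn1 eq_sym xn0.
  by rewrite (le_trans (nondecr_cdf01_le dpsi mpsi x01))// nonincr_cdf01_ge.
- under eq_integral do rewrite /gap_density mulrC EFinM.
  rewrite integralZl//= -[X in (_ * X)%E]fineK; last first.
    exact: integrable_fin_num.
  by rewrite -EFinM mulVf// gt_eqF.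
Qed.

End construction.

(* Main.v *)
(* Set F = Phi - id and G = id - Psi: both are concave, nonnegative and vanish at
   0 and 1, H = F + G, and gini rho = 2 * int (cdf * (1 - cdf)).  Write f, g for the
   integrals of F, G over [0, 1], so that A = f + g.
   - From P ^ 2 >= 2 x P - x ^ 2 one gets
     D(p) <= 1/3 + (1/A) int (1/3 - 2 x (1 - x)) H.
   - The reverse Hoelder inequality int F ^ 2 <= (4/3) f ^ 2 for concave functions and
     int F G >= f g / 3 give
     D(q) >= 1/3 + int (1 - 2 x) (F - G) - (2/3) (f ^ 2 + g ^ 2) + f g / 3.
   - If A >= 1/2, then D(q) >= A - (1/2) int H ^ 2 >= A - (2/3) A ^ 2 >= 1/3 >= D(p).
   - If A <= 1/2, the two bounds are compared through moment inequalities for F and G.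
     A nonincreasing density is a mixture of uniform laws on [0, a]; with u = 1 - a and E
     the mixture, they say E((u - r) ^ 2 * (1 - u)) >= 0 and E((u - r) ^ 2) >= 0.  The
     choices r = A on the side of max(f, g) and r = 2 min(f, g) on the other side
     leave a polynomial inequality in f and g. *)
Require Import Defs.
From mathcomp Require Import all_boot all_order all_algebra.
From mathcomp Require Import all_classical all_reals all_analysis.
From mathcomp Require Import measurable_realfun ring lra.
Import Order.TTheory GRing.Theory Num.Theory.
Import numFieldNormedType.Exports.
Set Implicit Arguments.
Unset Strict Implicit.
Local Open Scope classical_set_scope.
Local Open Scope ring_scope.

(** * Integrals over [[0, x]] and integration by parts *)

Section primitives.
Context {R : realType}.
Implicit Types (u v : R -> R) (a b c x : R).
Local Notation mu := (@lebesgue_measure R).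

Definition integrable01 u := mu.-integrable `[0, 1] (EFin \o u).

Lemma integrable01_sub u (i j : itv_bound R) : integrable01 u ->
  (BLeft 0 <= i)%O -> (j <= BRight 1)%O ->
  mu.-integrable [set` Interval i j] (EFin \o u).
Proof. by move=> iu i0 j1; apply: integrableS iu => //=; exact: subset_itv. Qed.

Lemma integrable01D u v : integrable01 u -> integrable01 v ->
  integrable01 (fun x => u x + v x).
Proof. exact: integrableD. Qed.

Lemma integrable01Z k u : integrable01 u -> integrable01 (fun x => k * u x).
Proof. exact: integrableZl. Qed.

Lemma integrable01B u v : integrable01 u -> integrable01 v ->
  integrable01 (fun x => u x - v x).
Proof. exact: integrableB. Qed.

Definition continuous01 u := {within `[0, 1], continuous u}.

Lemma continuous01_integrable u : continuous01 u -> integrable01 u.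
Proof.
by move=> cu; apply: continuous_compact_integrable => //; exact: segment_compact.
Qed.

(** A continuous [u] is bounded on the compact [[0, 1]], so [|u v|] is dominated by a multiple of
    [|v|]. *)
Lemma integrable01M u v : continuous01 u -> integrable01 v ->
  integrable01 (fun x => u x * v x).
Proof.
move=> cu iv.
have := compact_bounded (continuous_compact cu (@segment_compact _ 0 1)).
have mu' : measurable_fun (`[0, 1] : set R) u.
  by apply/measurable_EFinP; exact: measurable_int (continuous01_integrable cu).
have mv : measurable_fun (`[0, 1] : set R) v.
  by apply/measurable_EFinP; exact: measurable_int iv.
move=> [M [_ Mu]].
(* [M] only guarantees a bound by every number above it, hence [M + 1]. *)
apply: (@le_integrable _ _ _ mu _ _ _ (EFin \o (fun x => (M + 1) * `|v x|))) => //.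
- by apply/measurable_EFinP; exact: measurable_funM.
- move=> x x01 /=; rewrite lee_fin normrM [leRHS]ger0_norm.
    apply: ler_wpM2r => //; apply: (Mu (M + 1)); first by rewrite ltrDl.
    by exists x.
  rewrite mulr_ge0//.
  have : `|u x| <= M + 1 by apply: (Mu (M + 1)); [rewrite ltrDl|exists x].
  exact: le_trans.
- have inv : integrable01 (fun x => `|v x|). by exact: (integrable_norm iv).
  exact: (integrable01Z (M + 1) inv).
Qed.

(** Endpoints are null; with the open interval, comparisons are only needed where the densities are
    monotone. *)
Lemma cdf01B_itv u a b : integrable01 u -> 0 <= a -> a <= b -> b <= 1 ->
  cdf01 u b - cdf01 u a = \int[mu]_(x in `]a, b[) u x.
Proof.
move=> iu a0 ab b1; rewrite /cdf01 Rintegral_itvB//=; last first.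
  by apply: integrable01_sub => //; rewrite bnd_simp.
rewrite -Rintegral_itv_bndo_bndc//.
by apply: integrable01_sub => //; rewrite bnd_simp.
Qed.

Lemma le_cdf01B u v a b : integrable01 u -> integrable01 v ->
  0 <= a -> a <= b -> b <= 1 -> {in `]a, b[, forall x, u x <= v x} ->
  cdf01 u b - cdf01 u a <= cdf01 v b - cdf01 v a.
Proof.
move=> iu iv a0 ab b1 uv; rewrite !cdf01B_itv//; apply: le_Rintegral => //.
- by apply: integrable01_sub => //; rewrite bnd_simp.
- by apply: integrable01_sub => //; rewrite bnd_simp.
Qed.

Lemma eq_cdf01 u v b : b <= 1 -> {in `[0, 1], u =1 v} -> cdf01 u b = cdf01 v b.
Proof.
move=> b1 uv; apply: eq_Rintegral => x; rewrite inE/= in_itv/= => /andP[x0 xb].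
by apply: uv; rewrite in_itv/= x0 (le_trans xb).
Qed.

Lemma cdf01D u v b : integrable01 u -> integrable01 v -> b <= 1 ->
  cdf01 (fun x => u x + v x) b = cdf01 u b + cdf01 v b.
Proof.
by move=> iu iv b1; apply: RintegralD => //; apply: integrable01_sub => //; rewrite bnd_simp.
Qed.

Lemma cdf01B u v b : integrable01 u -> integrable01 v -> b <= 1 ->
  cdf01 (fun x => u x - v x) b = cdf01 u b - cdf01 v b.
Proof.
by move=> iu iv b1; apply: RintegralB => //; apply: integrable01_sub => //; rewrite bnd_simp.
Qed.

Lemma cdf01Z k u b : integrable01 u -> b <= 1 ->
  cdf01 (fun x => k * u x) b = k * cdf01 u b.
Proof.
by move=> iu b1; apply: RintegralZl => //; apply: integrable01_sub => //; rewrite bnd_simp.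
Qed.

Lemma cdf01_within_continuous u : integrable01 u -> continuous01 (cdf01 u).
Proof. by move=> iu; exact: parameterized_integral_continuous. Qed.

Lemma continuous01D u v : continuous01 u -> continuous01 v ->
  continuous01 (fun x => u x + v x).
Proof. by move=> cu cv x; apply: continuousD; [exact: cu|exact: cv]. Qed.

Lemma cdf01_cst k x : 0 <= x -> cdf01 (cst k) x = k * x.
Proof.
move=> x0; rewrite /cdf01 Rintegral_cst//= lebesgue_measure_itv/= lte_fin.
have [->|] := eqVneq x 0; first by rewrite ltxx mulr0.
by rewrite lt_neqAle x0 andbT eq_sym => ->; rewrite -EFinD /= subr0.
Qed.

Lemma EFin_cdf01 u b : integrable01 u -> b <= 1 ->
  (cdf01 u b)%:E = (\int[mu]_x ((u \_ `[0, b]) x)%:E)%E.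
Proof.
move=> iu b1; rewrite /cdf01 /Rintegral fineK; last first.
  apply: integrable_fin_num => //.
  by apply: integrable01_sub => //; rewrite bnd_simp.
by rewrite integral_mkcond restrict_EFin.
Qed.

(* Fubini on the triangle 0 <= y <= x <= b. *)
Lemma cdf01_by_parts u v b : integrable01 u -> integrable01 v ->
  0 <= b -> b <= 1 ->
  cdf01 (fun x => u x * cdf01 v x + cdf01 u x * v x) b = cdf01 u b * cdf01 v b.
Proof.
move=> iu iv b0 b1.
have ibu : mu.-integrable `[0, b] (EFin \o u) by apply: integrable01_sub => //; rewrite bnd_simp.
have ibv : mu.-integrable `[0, b] (EFin \o v) by apply: integrable01_sub => //; rewrite bnd_simp.
pose u' := u \_ `[0, b]; pose v' := v \_ `[0, b].
have mu'T : measurable_fun [set: R] u'.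
  by apply/(measurable_restrictT _ _).1 => //; apply/measurable_EFinP; exact: measurable_int ibu.
have mv'T : measurable_fun [set: R] v'.
  by apply/(measurable_restrictT _ _).1 => //; apply/measurable_EFinP; exact: measurable_int ibv.
(* The kernel [u(x) v(y)] on the square [[0, b]^2], cut down to the triangle [y <= x]. *)
pose T (z : R * R) := u' z.1 * v' z.2 * (z.2 <= z.1)%R%:R.
have mT : measurable_fun [set: R * R] T.
  apply: measurable_funM.
    by apply: measurable_funM; apply: measurableT_comp.
  apply: (measurableT_comp (f := fun c : bool => c%:R : R)) => //.
  exact: measurable_fun_ler.
have iu' : mu.-integrable [set: R] (EFin \o u').
  by rewrite -restrict_EFin; apply/(integrable_mkcond _ _).1.
have iv' : mu.-integrable [set: R] (EFin \o v').
  by rewrite -restrict_EFin; apply/(integrable_mkcond _ _).1.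
(* By Tonelli it suffices that [|T|] is dominated by [|u'(x)| |v'(y)|], whose iterated integral is
   finite. *)
have iT : (mu \x mu)%E.-integrable [set: R * R] (EFin \o T).
  apply/integrable12ltyP; first exact/measurable_EFinP.
  have /integrableP[_ v'oo] := iv'; have /integrableP[_ u'oo] := iu'.
  have v'fin : (\int[mu]_y `|(EFin \o v') y| \is a fin_num)%E.
    by rewrite ge0_fin_numE// integral_ge0.
  apply: (@le_lt_trans _ _ (\int[mu]_x ((\int[mu]_y `|(EFin \o v') y|) * `|(EFin \o u') x|)))%E.
    apply: ge0_le_integral => //.
    - by move=> x _; apply: integral_ge0.
    - apply: (@measurable_fun_fubini_tonelli_F _ _ _ _ _ mu (abse \o (EFin \o T))) => //.
        by apply: measurableT_comp => //; exact/measurable_EFinP.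
      by move=> z; exact: abse_ge0.
    - by apply: measurable_funeM => //; apply/measurable_EFinP; exact: measurableT_comp.
    - move=> x _.
      rewrite muleC -ge0_integralZl//; last by apply/measurable_EFinP; exact: measurableT_comp.
      apply: ge0_le_integral => //.
      + apply: measurableT_comp => //; apply/measurable_EFinP.
        by apply: (measurableT_comp mT); exact: pair1_measurable.
      + by apply: measurable_funeM => //; apply/measurable_EFinP; exact: measurableT_comp.
      + move=> y _; rewrite /T /= lee_fin !normrM normr_nat ler_piMr//.
        by case: (y <= x).
  rewrite ge0_integralZl//; last 2 first.
    - by apply/measurable_EFinP; exact: measurableT_comp.
    - exact: integral_ge0.
  by apply: lte_mul_pinfty => //; exact: integral_ge0.
have := Fubini iT.
(* Integrating in [y] first leaves [u(x)] times the integral of [v] over [[0, x]]. *)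
have -> : (\int[mu]_x \int[mu]_y (EFin \o T) (x, y) =
    (cdf01 (fun x => u x * cdf01 v x) b)%:E)%E.
  rewrite EFin_cdf01//; last first.
    under [X in integrable01 X]funext do rewrite mulrC.
    apply: integrable01M => //; exact: cdf01_within_continuous.
  apply: eq_integral => x _; rewrite /T /u' /v' /= /patch; case: ifPn => xb; last first.
    by under eq_integral do rewrite !mul0r; rewrite integral0.
  move: xb; rewrite inE/= in_itv/= => /andP[x0 xb].
  have x1 : x <= 1 by exact: le_trans b1.
  rewrite -cdf01Z// EFin_cdf01//; last exact: integrable01Z.
  apply: eq_integral => y _; rewrite /patch !mem_setE !in_itv/=.
  have [yx|xy] := leP y x; last by rewrite andbF mulr0.
  by rewrite (le_trans yx xb) mulr1 andbT; case: ifPn; rewrite ?mulr0.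
(* Integrating in [x] first leaves [v(y)] times the integral of [u] over [[y, b]], which is
   [cdf01 u b - cdf01 u y]. *)
have -> : (\int[mu]_y \int[mu]_x (EFin \o T) (x, y) =
    (cdf01 (fun y => cdf01 u b * v y - cdf01 u y * v y) b)%:E)%E.
  rewrite EFin_cdf01//; last first.
    apply: integrable01B; first exact: integrable01Z.
    by apply: integrable01M => //; exact: cdf01_within_continuous.
  apply: eq_integral => y _; rewrite /T /u' /v' /= /patch; case: ifPn => yb; last first.
    by under eq_integral do rewrite mulr0 mul0r; rewrite integral0.
  move: yb; rewrite inE/= in_itv/= => /andP[y0 yb].
  rewrite -mulrBl.
  have y1 : y <= 1 by exact: le_trans b1.
  rewrite cdf01B_itv// mulrC -RintegralZl//; last by apply: integrable01_sub => //; rewrite bnd_simp.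
  rewrite Rintegral_itv_bndo_bndc; last first.
    by apply: (integrable01_sub (integrable01Z _ iu)) => //; rewrite bnd_simp.
  rewrite Rintegral_itv_obnd_cbnd; last first.
    by apply: (integrable01_sub (integrable01Z _ iu)) => //; rewrite bnd_simp.
  rewrite /Rintegral fineK; last first.
    apply: integrable_fin_num => //.
    by apply: (integrable01_sub (integrable01Z _ iu)) => //; rewrite bnd_simp.
  rewrite integral_mkcond restrict_EFin.
  have H (x : R) : (u \_ `[0, b]) x * v y * (y <= x)%R%:R =
      ((fun t => v y * u t) \_ `[y, b]) x.
    rewrite /patch !mem_setE !in_itv/=; have [yx|xy] := leP y x; last by rewrite mulr0.
    by rewrite (le_trans y0 yx) mulr1/=; case: ifPn; rewrite ?mul0r// mulrC.
  by apply: eq_integral => x _; congr EFin; exact: H.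
move=> [].
have iUv : integrable01 (fun x => cdf01 u x * v x).
  by apply: integrable01M => //; exact: cdf01_within_continuous.
have iuV : integrable01 (fun x => u x * cdf01 v x).
  under [X in integrable01 X]funext do rewrite mulrC.
  by apply: integrable01M => //; exact: cdf01_within_continuous.
rewrite (cdf01D iuV iUv b1) (cdf01B (integrable01Z (cdf01 u b) iv) iUv b1) => ->.
by rewrite cdf01Z// subrK.
Qed.
End primitives.

(** * Calculus of absolutely continuous functions on [[0, 1]] *)

Section antiderivatives.
Context {R : realType}.
Implicit Types (u v h U V F : R -> R) (a b c d x : R).

(* U is absolutely continuous on [0, 1] with almost everywhere derivative u. *)
Definition primitive01 U u :=
  integrable01 u /\ {in `[0, 1], forall x, U x = U 0 + cdf01 u x}.

Lemma primitive01_cdf01 u : integrable01 u -> primitive01 (cdf01 u) u.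
Proof. by move=> iu; split=> // x _; rewrite cdf01_0 add0r. Qed.

Lemma integrable01_ext u v : {in `[0, 1], u =1 v} -> integrable01 u -> integrable01 v.
Proof.
move=> uv; apply: eq_integrable => // x; rewrite inE/= => x01 /=; congr EFin.
exact: uv.
Qed.

Lemma primitive01_ext U u v : {in `[0, 1], u =1 v} -> primitive01 U u ->
  primitive01 U v.
Proof.
move=> uv [iu Uu]; split=> [|x x01]; first exact: integrable01_ext uv iu.
rewrite Uu//; congr (_ + _).
by apply: eq_cdf01 => //; move: x01; rewrite in_itv/= => /andP[].
Qed.

Lemma continuous01_ext u v : {in `[0, 1], u =1 v} -> continuous01 u -> continuous01 v.
Proof.
move=> uv cu; apply: (@subspace_eq_continuous _ _ _ u) => //.
by move=> x; rewrite inE => xA; exact: uv.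
Qed.

Lemma cst_continuous01 k : continuous01 (cst k : R -> R).
Proof. by apply: continuous_subspaceT => x; exact: cst_continuous. Qed.

Lemma primitive01_continuous U u : primitive01 U u -> continuous01 U.
Proof.
move=> [iu Uu]; apply: (@continuous01_ext (fun x => U 0 + cdf01 u x)).
  by move=> x x01; rewrite -Uu.
apply: continuous01D; [exact: cst_continuous01|exact: cdf01_within_continuous].
Qed.

Lemma primitive01_integrable U u : primitive01 U u -> integrable01 U.
Proof. by move=> /primitive01_continuous; exact: continuous01_integrable. Qed.

Lemma primitive01_cst k : primitive01 (cst k) (cst 0).
Proof.
split; first exact/continuous01_integrable/cst_continuous01.
by move=> x; rewrite in_itv/= => /andP[x0 _]; rewrite cdf01_cst// mul0r addr0.
Qed.

Lemma primitive01_id : primitive01 id (cst 1).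
Proof.
split; first exact/continuous01_integrable/cst_continuous01.
by move=> x; rewrite in_itv/= => /andP[x0 _]; rewrite cdf01_cst// mul1r add0r.
Qed.

Lemma primitive01D U u V v : primitive01 U u -> primitive01 V v ->
  primitive01 (fun x => U x + V x) (fun x => u x + v x).
Proof.
move=> [iu Uu] [iv Vv]; split; first exact: integrable01D.
move=> x x01; rewrite (Uu _ x01) (Vv _ x01) cdf01D//; first by ring.
by move: x01; rewrite in_itv/= => /andP[].
Qed.

Lemma primitive01Z k U u : primitive01 U u ->
  primitive01 (fun x => k * U x) (fun x => k * u x).
Proof.
move=> [iu Uu]; split; first exact: integrable01Z.
move=> x x01; rewrite (Uu _ x01) cdf01Z//; first by ring.
by move: x01; rewrite in_itv/= => /andP[].
Qed.

Lemma primitive01B U u V v : primitive01 U u -> primitive01 V v ->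
  primitive01 (fun x => U x - V x) (fun x => u x - v x).
Proof.
move=> [iu Uu] [iv Vv]; split; first exact: integrable01B.
move=> x x01; rewrite (Uu _ x01) (Vv _ x01) cdf01B//; first by ring.
by move: x01; rewrite in_itv/= => /andP[].
Qed.

(** Writing [U = U 0 + cdf01 u] and [V = V 0 + cdf01 v] splits the derivative into linear terms and
    the integrand of [cdf01_by_parts]. *)
Lemma primitive01M U u V v : primitive01 U u -> primitive01 V v ->
  primitive01 (fun x => U x * V x) (fun x => u x * V x + U x * v x).
Proof.
move=> pU pV; have [iu Uu] := pU; have [iv Vv] := pV.
have iuV : integrable01 (fun x => u x * V x).
  under [X in integrable01 X]funext do rewrite mulrC.
  by apply: integrable01M => //; exact: primitive01_continuous pV.
have iUv : integrable01 (fun x => U x * v x).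
  by apply: integrable01M => //; exact: primitive01_continuous pU.
split; first exact: integrable01D.
move=> x x01; have /andP[x0 x1] : 0 <= x <= 1 by move: x01; rewrite in_itv.
have := cdf01_by_parts iu iv x0 x1.
have i1 : integrable01 (fun x => u x * cdf01 v x).
  under [X in integrable01 X]funext do rewrite mulrC.
  by apply: integrable01M => //; exact: cdf01_within_continuous.
have i2 : integrable01 (fun x => cdf01 u x * v x).
  by apply: integrable01M => //; exact: cdf01_within_continuous.
rewrite (@eq_cdf01 _ (fun x => u x * V x + U x * v x)
  (fun x => (V 0 * u x + U 0 * v x) + (u x * cdf01 v x + cdf01 u x * v x)) x)//; last first.
  by move=> t t01; rewrite (Uu _ t01) (Vv _ t01); ring.
rewrite (cdf01D (u := fun x => V 0 * u x + U 0 * v x))//; last 2 first.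
- by apply: integrable01D; exact: integrable01Z.
- exact: integrable01D.
rewrite (cdf01D (u := fun x => V 0 * u x))//; [|exact: integrable01Z|exact: integrable01Z].
rewrite !cdf01Z// => ->.
by rewrite (Uu _ x01) (Vv _ x01); ring.
Qed.

(** The workhorse for the integral inequalities below: assemble a primitive that encodes the
    inequality, then check the sign of its derivative on the open interval. *)
Lemma primitive01_le U u a b : primitive01 U u -> 0 <= a -> a <= b -> b <= 1 ->
  {in `]a, b[, forall x, 0 <= u x} -> U a <= U b.
Proof.
move=> [iu Uu] a0 ab b1 u0.
have i0 : integrable01 (cst 0 : R -> R) by exact/continuous01_integrable/cst_continuous01.
have := le_cdf01B i0 iu a0 ab b1 u0.
rewrite !cdf01_cst ?(le_trans a0)// !mul0r subrr subr_ge0 => uab.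
rewrite (Uu a) ?(Uu b) ?lerD2l// in_itv/= ?a0 ?b1 ?(le_trans a0)//.
by rewrite (le_trans ab).
Qed.

End antiderivatives.

(** * The Gini mean difference in terms of the distribution function *)

Section gini.
Context {R : realType}.
Local Notation mu := (@lebesgue_measure R).
Local Open Scope ereal_scope.

(** [|x - y|] is the length of the set of levels [t] separating [x] from [y]. The half-open form
    matches the events [x <= t] and [t < x] of a distribution function and its tail. *)
Lemma dist_integral (x y : R) :
  `|x - y|%:E = \int[mu]_t ((x <= t < y)%R || (y <= t < x)%R)%:R%:E.
Proof.
have H (z w : R) : (z <= w)%R ->
  `|z - w|%:E = \int[mu]_t ((z <= t < w)%R || (w <= t < z)%R)%:R%:E.
  move=> zw; transitivity (\int[mu]_(t in `[z, w[) (cst 1) t).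
    rewrite integral_cst//= mul1e lebesgue_measure_itv/= lte_fin.
    have [zw'|wz] := ltP z w; first by rewrite -EFinD distrC ger0_norm// subr_ge0.
    by have -> : z = w; [apply/eqP; rewrite eq_le zw|rewrite subrr normr0].
  rewrite integral_mkcond; apply: eq_integral => t _.
  rewrite /patch mem_setE in_itv/=.
  have -> : (w <= t < z)%R = false.
    by apply/negbTE/negP => /andP[wt /(le_lt_trans wt)]; rewrite ltNge zw.
  by rewrite orbF; case: ifPn.
have [xy|/ltW yx] := leP x y; first exact: H.
by rewrite distrC H//; apply: eq_integral => t _; rewrite orbC.
Qed.

(** After Tonelli, the pairs separated by a fixed [t] form the disjoint union of the rectangles [E1]
    and [E2], which have equal mass. *)
Lemma gini_integral (rho : probability (measurableTypeR R) R) :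
  gini rho = \int[mu]_t (2%:E * rho [set x | x <= t]%R * rho [set x | t < x]%R).
Proof.
rewrite /gini.
under eq_integral do rewrite dist_integral.
pose f (z : (R * R) * R) : \bar R :=
  ((z.1.1 <= z.2 < z.1.2)%R || (z.1.2 <= z.2 < z.1.1)%R)%:R%:E.
rewrite (_ : \int[rho \x rho]_z _ = \int[rho \x rho]_z \int[mu]_t f (z, t))//.
have mf : measurable_fun setT f.
  apply/measurable_EFinP; apply: (measurableT_comp (f := fun c : bool => c%:R : R)) => //.
  have m11 : measurable_fun [set: R * R * R] (fun z => z.1.1) by exact: measurableT_comp.
  have m12 : measurable_fun [set: R * R * R] (fun z => z.1.2) by exact: measurableT_comp.
  by apply: measurable_or; apply: measurable_and;
    do ?[exact: measurable_fun_ler|exact: measurable_fun_ltr].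
pose P : probability (measurableTypeR R * measurableTypeR R)%type R := (rho \x rho).
transitivity (\int[mu]_t \int[P]_z f (z, t)).
  apply: (fubini_tonelli (m1 := P) (m2 := mu) f) => //.
  by move=> z; rewrite lee_fin.
apply: eq_integral => t _.
have mle : measurable [set x : measurableTypeR R | x <= t]%R.
  by rewrite -set_itvNyc; exact: measurable_itv.
have mlt : measurable [set x : measurableTypeR R | t < x]%R.
  by rewrite -set_itvoy; exact: measurable_itv.
pose E1 := [set x : measurableTypeR R | x <= t]%R `*` [set x : measurableTypeR R | t < x]%R.
pose E2 := [set x : measurableTypeR R | t < x]%R `*` [set x : measurableTypeR R | x <= t]%R.
transitivity (\int[P]_z (\1_(E1 `|` E2) z)%:E).
  apply: eq_integral => -[x y] _; rewrite /f /= indicE; congr (_%:R%:E).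
  congr nat_of_bool; apply/idP/idP; rewrite inE /=.
    by move=> /orP[/andP[? ?]|/andP[? ?]]; [left|right].
  by move=> [[/= -> ->]|[/= -> ->]]; rewrite ?orbT.
rewrite integral_indic//; last by apply: measurableU; exact: measurableX.
have PE A B : measurable A -> measurable B -> P (A `*` B) = rho A * rho B.
  exact: product_measure1E.
rewrite setIT; transitivity (P E1 + P E2).
  apply: measureU; [exact: measurableX|exact: measurableX|].
  apply/seteqP; split=> // -[x y] [[/= xt _] [/= tx _]].
  by have := le_lt_trans xt tx; rewrite ltxx.
rewrite /E1 /E2 !PE// -(fineK (fin_num_measure rho _ mle)) -(fineK (fin_num_measure rho _ mlt)).
by rewrite -!EFinM -EFinD; congr EFin; ring.
Qed.

(** The distribution function is 0 to the left of [[0, 1]] and 1 to its right, so the integrand of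
    [gini_integral] vanishes outside [[0, 1]]. *)
Lemma gini_density_prob (f : R -> R) (df : density01 f) :
  gini (density_prob df) = (cdf01 (fun x => 2 * cdf01 f x * (1 - cdf01 f x))%R 1)%:E.
Proof.
have [mf f0 f1] := df; have fi := density01_integrable df.
have pF := primitive01_cdf01 fi.
pose rho : probability (measurableTypeR R) R := density_prob df.
rewrite (gini_integral rho) EFin_cdf01//; last first.
  have pD := primitive01B (primitive01_cst 1%R) pF.
  exact: primitive01_integrable (primitive01M (primitive01Z 2 pF) pD).
apply: eq_integral => t _.
have mle : measurable [set x : measurableTypeR R | x <= t]%R.
  by rewrite -set_itvNyc; exact: measurable_itv.
have -> : rho [set x | t < x]%R = 1 - rho [set x | x <= t]%R.
  rewrite -probability_setC//; congr (rho _).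
  by apply/seteqP; split=> x /=; rewrite ltNge => /negP.
suff -> : rho [set x | x <= t]%R =
    (if (t < 0)%R then 0 else if (t <= 1)%R then cdf01 f t else 1%R)%:E.
  rewrite -EFinB -!EFinM /patch mem_setE in_itv/=; congr EFin.
  have [t0|t0] := ltP t 0%R; first by rewrite mulr0 mul0r.
  by have [t1|t1] := leP t 1%R; rewrite //= subrr mulr0.
have -> : rho [set x | x <= t]%R =
    \int[mu]_(x in [set x | x <= t]%R `&` `[0%R, 1%R]) (f x)%:E by [].
have [t0|t0] := ltP t 0%R.
  rewrite (_ : _ `&` _ = set0) ?integral_set0//.
  apply/seteqP; split=> // x [/= xt]; rewrite in_itv/= => /andP[x0 _].
  by have := le_lt_trans (le_trans x0 xt) t0; rewrite ltxx.
have [t1|t1] := leP t 1%R.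
  rewrite EFin_cdf01// (_ : _ `&` _ = `[0%R, t]%classic).
    by rewrite integral_mkcond restrict_EFin.
  apply/seteqP; split=> x /=; rewrite !in_itv/=.
    by move=> [-> /andP[->]].
  by move=> /andP[-> xt]; rewrite xt (le_trans xt t1).
rewrite (_ : _ `&` _ = `[0%R, 1%R]%classic) ?f1//.
apply/seteqP; split=> x /=; rewrite !in_itv/=; first by case.
by move=> /andP[-> x1]; rewrite x1 (le_trans x1 (ltW t1)).
Qed.

End gini.

(** * Concave functions vanishing at 0 and 1 *)

Section concave.
Context {R : realType}.
Implicit Types (u v h k U V F G : R -> R) (a b c d x s : R).

(** The function [h x * t - cdf01 h t] of [t] has derivative [h x - h t], nonpositive before [x] and
    nonnegative after it, hence a minimum at [x]. *)
Lemma cdf01_supergradient h x s : integrable01 h -> nonincreasing01 h ->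
  x \in `]0, 1[ -> s \in `[0, 1] -> cdf01 h s <= cdf01 h x + h x * (s - x).
Proof.
move=> ih mh x01 s01; have /andP[x0 x1] : 0 < x < 1 by move: x01; rewrite in_itv.
have /andP[s0 s1] : 0 <= s <= 1 by move: s01; rewrite in_itv.
have pW := primitive01B (primitive01Z (h x) (@primitive01_id R)) (primitive01_cdf01 ih).
have [xs|/ltW sx] := leP x s.
  suff /(primitive01_le pW (ltW x0) xs s1) : {in `]x, s[, forall t, 0 <= h x * cst 1 t - h t}.
    by rewrite /=; lra.
  move=> t; rewrite in_itv/= => /andP[xt ts]; rewrite mulr1 subr_ge0 mh ?(ltW xt)//.
  by rewrite in_itv/= (lt_trans x0 xt) (lt_le_trans ts).
have pW' := primitive01B (primitive01_cdf01 ih) (primitive01Z (h x) (@primitive01_id R)).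
suff /(primitive01_le pW' s0 sx (ltW x1)) : {in `]s, x[, forall t, 0 <= h t - h x * cst 1 t}.
  by rewrite /=; lra.
move=> t; rewrite in_itv/= => /andP[st tx]; rewrite mulr1 subr_ge0 mh ?(ltW tx)//.
by rewrite in_itv/= (le_lt_trans s0 st) (lt_trans tx).
Qed.

Section one_function.
Variable h : R -> R.
Hypotheses (ih : integrable01 h) (mh : nonincreasing01 h) (h1 : cdf01 h 1 = 0).
Local Notation F := (cdf01 h).
Local Notation f := (cdf01 F 1).

Let pF : primitive01 F h. Proof. exact: primitive01_cdf01. Qed.
Let pK : primitive01 (cdf01 F) F.
Proof. exact: primitive01_cdf01 (primitive01_integrable pF). Qed.

(** The supporting line at [x], evaluated at 0, lies above [F 0 = 0]. *)
Lemma intercept0_ge0 x : x \in `]0, 1[ -> 0 <= F x - x * h x.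
Proof.
move=> x01; have := cdf01_supergradient (s := 0) ih mh x01.
by rewrite cdf01_0 in_itv/= lexx ler01 => /(_ isT); lra.
Qed.

Lemma intercept1_ge0 x : x \in `]0, 1[ -> 0 <= F x + (1 - x) * h x.
Proof.
move=> x01; have := cdf01_supergradient (s := 1) ih mh x01.
by rewrite h1 in_itv/= lexx ler01 => /(_ isT); lra.
Qed.

(** Integrate the supergradient inequality over [[0, 1]]: the mean of a line is its value at
    [1 / 2]. *)
Lemma concave_integral_le x : x \in `]0, 1[ ->
  f <= F x + h x * (1 / 2 - x).
Proof.
move=> x01.
pose pX := @primitive01_id R.
have := primitive01B (primitive01D (primitive01Z (F x - h x * x) pX)
  (primitive01Z (h x / 2) (primitive01M pX pX))) pK.
move=> /primitive01_le /(_ (lexx 0) ler01 (lexx 1)).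
rewrite /= cdf01_0 => H.
suff : {in `]0, 1[, forall t : R, 0 <= (F x - h x * x) * 1 + h x / 2 * (1 * t + t * 1) - F t}.
  by move=> /H; lra.
move=> t t01; have := cdf01_supergradient (s := t) ih mh x01.
rewrite in_itv/=; move: t01; rewrite in_itv/= => /andP[/ltW -> /ltW ->] /(_ isT); lra.
Qed.

(** Add [2 x] times [concave_integral_le] and [1 - 2 x] times [intercept0_ge0]. With the mirror
    image below, [F] lies above the tent [2 f min(x, 1 - x)]. *)
Lemma concave_ge_left x : 0 < x -> x <= 1 / 2 -> 2 * f * x <= F x.
Proof.
move=> x0 x2; have x01 : x \in `]0, 1[ by rewrite in_itv/=; apply/andP; split; lra.
have H1 := concave_integral_le x01; have H2 := intercept0_ge0 x01.
nra.
Qed.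

Lemma concave_ge_right x : 1 / 2 <= x -> x < 1 -> 2 * f * (1 - x) <= F x.
Proof.
move=> x0 x2; have x01 : x \in `]0, 1[ by rewrite in_itv/=; apply/andP; split; lra.
have H1 := concave_integral_le x01; have H2 := intercept1_ge0 x01.
nra.
Qed.

(** [F x] is the convex combination of the two intercepts with weights [1 - x] and [x]. *)
Lemma concave_ge0 x : x \in `]0, 1[ -> 0 <= F x.
Proof.
move=> x01; have H0 := intercept0_ge0 x01; have H1 := intercept1_ge0 x01.
move: x01; rewrite in_itv/= => /andP[x0 x1]; nra.
Qed.

Lemma concave_integral_ge0 : 0 <= f.
Proof.
by have /primitive01_le/(_ (lexx 0) ler01 (lexx 1) concave_ge0) := pK; rewrite cdf01_0.
Qed.

(* With N x := F x - x * h x, the intercept at 0 of the tangent at x, and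
   n := cdf01 N, nonnegativity of the intercept at 1 makes F + n nondecreasing;
   hence F + n <= n 1 = 2 * f.  Multiply this by N and integrate. *)
Lemma concave_sqr_le : cdf01 (fun x => F x * F x) 1 <= 4 / 3 * f ^+ 2.
Proof.
pose pX := @primitive01_id R.
have pS : primitive01 (cdf01 (fun x => F x * F x)) (fun x => F x * F x).
  by apply: primitive01_cdf01; exact: primitive01_integrable (primitive01M pF pF).
(* [n = 2 * cdf01 F - x * F], since its derivative is [F - x h = N]. *)
have pn := primitive01B (primitive01Z 2 pK) (primitive01M pX pF).
have nF x : x \in `]0, 1[ -> F x + (2 * cdf01 F x - x * F x) <= 2 * f.
  move=> x01; have /andP[x0 x1] : 0 < x < 1 by move: x01; rewrite in_itv.
  have /primitive01_le /(_ (ltW x0) (ltW x1) (lexx 1)) := primitive01D pF pn.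
  rewrite h1 => H.
  suff /H : {in `]x, 1[, forall t : R, 0 <= h t + (2 * F t - (cst 1 t * F t + t * h t))}.
    by rewrite /=; lra.
  move=> t; rewrite in_itv/= => /andP[xt t1].
  have t01 : t \in `]0, 1[ by rewrite in_itv/= (lt_trans x0).
  by have := intercept1_ge0 t01; lra.
(* The derivative of this combination is [N * (2 f - F - n)], because [F N] is [3/2 F^2] minus the
   derivative of [x F^2 / 2]. Its increment over [[0, 1]] is [2 f^2] minus [3/2] times the integral
   of [F^2]. *)
have := primitive01B (primitive01D (primitive01B (primitive01Z (2 * f) pn)
  (primitive01Z (1 / 2) (primitive01M pn pn)))
  (primitive01Z (1 / 2) (primitive01M pX (primitive01M pF pF))))
  (primitive01Z (3 / 2) pS).
move=> /primitive01_le /(_ (lexx 0) ler01 (lexx 1)).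
rewrite /= !cdf01_0 h1 => H.
suff /H : {in `]0, 1[, forall x : R, 0 <=
  2 * f * (2 * F x - (1 * F x + x * h x)) - 1 / 2 *
   ((2 * F x - (1 * F x + x * h x)) * (2 * cdf01 F x - x * F x) +
     (2 * cdf01 F x - x * F x) * (2 * F x - (1 * F x + x * h x))) +
  1 / 2 * (1 * (F x * F x) + x * (h x * F x + F x * h x)) - 3 / 2 * (F x * F x)}.
  by nra.
move=> x x01; have H1 := nF x x01; have H2 := intercept0_ge0 x01.
have : 0 <= (2 * f - (F x + (2 * cdf01 F x - x * F x))) * (F x - x * h x).
  by rewrite mulr_ge0// subr_ge0.
lra.
Qed.

End one_function.

End concave.

(** * Products of concave functions, and pairings with sign-changing functions *)

Section more.
Context {R : realType}.
Implicit Types (u v h k U V F G phi psi gam Gam : R -> R) (a b c d x s : R).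

(** Both functions lie above tents [2 f min(x, 1 - x)] and [2 g min(x, 1 - x)], whose product has
    integral [f g / 3]. *)
Lemma concave_prod_ge h k : integrable01 h -> integrable01 k ->
  nonincreasing01 h -> nonincreasing01 k -> cdf01 h 1 = 0 -> cdf01 k 1 = 0 ->
  cdf01 (cdf01 h) 1 * cdf01 (cdf01 k) 1 / 3 <= cdf01 (fun x => cdf01 h x * cdf01 k x) 1.
Proof.
move=> ih ik mh mk h1 k1.
pose f := cdf01 (cdf01 h) 1; pose g := cdf01 (cdf01 k) 1.
have f0 : 0 <= f by exact: concave_integral_ge0.
have g0 : 0 <= g by exact: concave_integral_ge0.
have pF := primitive01_cdf01 ih; have pG := primitive01_cdf01 ik.
have pX := @primitive01_id R.
have pP := primitive01_cdf01 (primitive01_integrable (primitive01M pF pG)).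
(* [4/3 f g x^3] is a primitive of [4 f g x^2], the product of the tents on the left half; [pR]
   serves the right half. *)
have pL := primitive01B pP (primitive01Z (4 / 3 * f * g) (primitive01M pX (primitive01M pX pX))).
have pY := primitive01B (primitive01_cst 1) pX.
have pR := primitive01D pP (primitive01Z (4 / 3 * f * g) (primitive01M pY (primitive01M pY pY))).
have half0 : 0 <= 1 / 2 :> R by lra.
have half1 : 1 / 2 <= 1 :> R by lra.
have HL := primitive01_le pL (lexx 0) half0 half1.
have HR := primitive01_le pR half0 half1 (lexx 1).
move: HL HR; rewrite /= cdf01_0 => HL HR.
have /HL : {in `]0, (1 / 2)[, forall x : R, 0 <=
   cdf01 h x * cdf01 k x - 4 / 3 * f * g * (1 * (x * x) + x * (1 * x + x * 1))}.
  move=> x; rewrite in_itv/= => /andP[x0 x2].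
  have Hf : 2 * f * x <= cdf01 h x by apply: concave_ge_left => //; exact: ltW.
  have Hg : 2 * g * x <= cdf01 k x by apply: concave_ge_left => //; exact: ltW.
  have : (2 * f * x) * (2 * g * x) <= cdf01 h x * cdf01 k x.
    by apply: ler_pM => //; rewrite ?mulr_ge0// ltW.
  lra.
have /HR : {in `](1 / 2), 1[, forall x : R, 0 <=
   cdf01 h x * cdf01 k x + 4 / 3 * f * g *
    ((0 - 1) * ((1 - x) * (1 - x)) +
     (1 - x) * ((0 - 1) * (1 - x) + (1 - x) * (0 - 1)))}.
  move=> x; rewrite in_itv/= => /andP[x0 x2].
  have Hf : 2 * f * (1 - x) <= cdf01 h x by apply: concave_ge_right => //; exact: ltW.
  have Hg : 2 * g * (1 - x) <= cdf01 k x by apply: concave_ge_right => //; exact: ltW.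
  have y0 : 0 <= 1 - x by rewrite subr_ge0 ltW.
  have : (2 * f * (1 - x)) * (2 * g * (1 - x)) <= cdf01 h x * cdf01 k x.
    by apply: ler_pM => //; rewrite ?mulr_ge0.
  lra.
rewrite -/f -/g; lra.
Qed.

(* On [0, c], gam * phi dominates phi d * gam, which has integral 0. *)
Lemma nonincreasing01_pairing phi gam Gam W c d :
  nonincreasing01 phi -> {in `]0, 1[, forall x, 0 <= phi x} ->
  primitive01 Gam gam -> primitive01 W (fun x => gam x * phi x) ->
  0 < d -> d <= c -> c <= 1 -> d < 1 ->
  {in `]0, d[, forall x, 0 <= gam x} -> {in `]d, c[, forall x, gam x <= 0} ->
  {in `]c, 1[, forall x, 0 <= gam x} -> Gam 0 = Gam c -> W 0 <= W 1.
Proof.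
move=> mphi phi0 pG pW d0 dc c1 d1 g1 g2 g3 Gc.
have c0 : 0 < c by exact: lt_le_trans dc.
have d01 : d \in `]0, 1[ by rewrite in_itv/= d0.
have := primitive01_le (primitive01B pW (primitive01Z (phi d) pG)) (lexx 0) (ltW c0) c1.
rewrite /= Gc => H1.
have {}H1 : W 0 <= W c.
  suff : {in `]0, c[, forall x : R, 0 <= gam x * phi x - phi d * gam x} by move=> /H1; lra.
  move=> x; rewrite in_itv/= => /andP[x0 xc].
  have x01 : x \in `]0, 1[ by rewrite in_itv/= x0 (lt_le_trans xc).
  (* Both factors of [(phi x - phi d) * gam x] change sign at [d]. *)
  rewrite mulrC -mulrBl.
  have [xd|dx|->] := ltgtP x d; last by rewrite subrr mul0r.
    by apply: mulr_ge0; [rewrite subr_ge0 mphi// ltW|apply: g1; rewrite in_itv/= x0].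
  by apply: mulr_le0; [rewrite subr_le0 mphi// ltW|apply: g2; rewrite in_itv/= dx].
apply: (le_trans H1); apply: (primitive01_le pW) => //; first exact: ltW.
move=> x xc1; rewrite mulr_ge0 ?g3// phi0//.
by move: xc1; rewrite !in_itv/= => /andP[/(lt_trans c0) -> ->].
Qed.

(** Mirror image: [gam * psi] is nonnegative on [[0, c]] and dominates [psi d * gam] on [[c, 1]],
    where [gam] has integral 0. *)
Lemma nondecreasing01_pairing psi gam Gam W c d :
  nondecreasing01 psi -> {in `]0, 1[, forall x, 0 <= psi x} ->
  primitive01 Gam gam -> primitive01 W (fun x => gam x * psi x) ->
  0 < d -> 0 <= c -> c <= d -> d < 1 ->
  {in `]0, c[, forall x, 0 <= gam x} -> {in `]c, d[, forall x, gam x <= 0} ->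
  {in `]d, 1[, forall x, 0 <= gam x} -> Gam c = Gam 1 -> W 0 <= W 1.
Proof.
move=> mpsi psi0 pG pW d0 c0 cd d1 g1 g2 g3 Gc.
have c1 : c < 1 by exact: le_lt_trans d1.
have d01 : d \in `]0, 1[ by rewrite in_itv/= d0.
have := primitive01_le (primitive01B pW (primitive01Z (psi d) pG)) c0 (ltW c1) (lexx 1).
rewrite /= Gc => H1.
have {}H1 : W c <= W 1.
  suff : {in `]c, 1[, forall x : R, 0 <= gam x * psi x - psi d * gam x} by move=> /H1; lra.
  move=> x; rewrite in_itv/= => /andP[xc x1].
  have x01 : x \in `]0, 1[ by rewrite in_itv/= x1 (le_lt_trans c0).
  rewrite mulrC -mulrBl.
  have [xd|dx|->] := ltgtP x d; last by rewrite subrr mul0r.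
    by apply: mulr_le0; [rewrite subr_le0 mpsi// ltW|apply: g2; rewrite in_itv/= xc].
  by apply: mulr_ge0; [rewrite subr_ge0 mpsi// ltW|apply: g3; rewrite in_itv/= dx].
apply: le_trans H1; apply: (primitive01_le pW) => //; first exact: ltW.
move=> x xc1; rewrite mulr_ge0 ?g1// psi0//.
by move: xc1; rewrite !in_itv/= => /andP[-> /lt_trans ->].
Qed.

End more.

(** * Moment inequalities from polynomial test functions *)

Section moments.
Context {R : realType}.
Implicit Types (h F M gam Gam dgam : R -> R) (a b c d x s : R).

Definition moment01 (n : nat) F : R := cdf01 (fun x => x ^+ n * F x) 1.

Lemma primitive01X n : exists u, primitive01 (fun x : R => x ^+ n) u.
Proof.
elim: n => [|n [u pu]].
  by exists (cst 0); under [X in primitive01 X]funext do rewrite expr0; exact: primitive01_cst.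
eexists; under [X in primitive01 X]funext do rewrite exprS.
by apply: primitive01M; [exact: primitive01_id|exact: pu].
Qed.

Lemma primitive01_moment n F h : primitive01 F h ->
  primitive01 (cdf01 (fun x => x ^+ n * F x)) (fun x => x ^+ n * F x).
Proof.
move=> pF; have [u pu] := primitive01X n.
by apply: primitive01_cdf01; exact: primitive01_integrable (primitive01M pu pF).
Qed.

Section one_function.
Variable h : R -> R.
Hypotheses (ih : integrable01 h) (mh : nonincreasing01 h) (h1 : cdf01 h 1 = 0).
Local Notation F := (cdf01 h).
Local Notation m0 := (moment01 0 F).
Local Notation m1 := (moment01 1 F).
Local Notation m2 := (moment01 2 F).

Let pF : primitive01 F h. Proof. exact: primitive01_cdf01. Qed.
Let pM n := primitive01_moment n pF.

(** Pair [gam] with the nonincreasing function [1 + h >= 0]. Integration by parts turns the integral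
    of [gam * (1 + h)] into [Gam 1 - Gam 0] minus that of [dgam * F]. *)
Lemma nonincreasing_moment_le Gam gam dgam M c d :
  {in `]0, 1[, forall x, -1 <= h x} ->
  primitive01 Gam gam -> primitive01 gam dgam -> primitive01 M (fun x => dgam x * F x) ->
  0 < d -> d <= c -> c <= 1 -> d < 1 ->
  {in `]0, d[, forall x, 0 <= gam x} -> {in `]d, c[, forall x, gam x <= 0} ->
  {in `]c, 1[, forall x, 0 <= gam x} -> Gam 0 = Gam c -> M 1 - M 0 <= Gam 1 - Gam 0.
Proof.
move=> hN1 pG pg pM' d0 dc c1 d1 g1 g2 g3 Gc.
have pW : primitive01 (fun x => Gam x + gam x * F x - M x) (fun x => gam x * (1 + h x)).
  apply: primitive01_ext (primitive01B (primitive01D pG (primitive01M pg pF)) pM').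
  by move=> x _ /=; ring.
have mphi : nonincreasing01 (fun x => 1 + h x).
  by move=> s t s01 t01 st; rewrite lerD2l mh.
have phi0 : {in `]0, 1[, forall x, 0 <= 1 + h x} by move=> x /hN1; lra.
have := nonincreasing01_pairing mphi phi0 pG pW d0 dc c1 d1 g1 g2 g3 Gc.
by rewrite h1 cdf01_0; lra.
Qed.

(** Here [gam] is paired with the nondecreasing function [1 - h >= 0], so the integral of [dgam * F]
    enters with the opposite sign. *)
Lemma nondecreasing_moment_le Gam gam dgam M c d :
  {in `]0, 1[, forall x, h x <= 1} ->
  primitive01 Gam gam -> primitive01 gam dgam -> primitive01 M (fun x => dgam x * F x) ->
  0 < d -> 0 <= c -> c <= d -> d < 1 ->
  {in `]0, c[, forall x, 0 <= gam x} -> {in `]c, d[, forall x, gam x <= 0} ->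
  {in `]d, 1[, forall x, 0 <= gam x} -> Gam c = Gam 1 -> M 0 - M 1 <= Gam 1 - Gam 0.
Proof.
move=> hN1 pG pg pM' d0 c0 cd d1 g1 g2 g3 Gc.
have pW : primitive01 (fun x => Gam x - gam x * F x + M x) (fun x => gam x * (1 - h x)).
  apply: primitive01_ext (primitive01D (primitive01B pG (primitive01M pg pF)) pM').
  by move=> x _ /=; ring.
have mpsi : nondecreasing01 (fun x => 1 - h x).
  by move=> s t s01 t01 st; rewrite lerD2l lerN2 mh.
have psi0 : {in `]0, 1[, forall x, 0 <= 1 - h x} by move=> x /hN1; lra.
have := nondecreasing01_pairing mpsi psi0 pG pW d0 c0 cd d1 g1 g2 g3 Gc.
by rewrite h1 cdf01_0; lra.
Qed.

Let pX := @primitive01_id R.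

(** The test function is [Gam = x^2 (c - x)^2], whose derivative changes sign at [c / 2] and [c].
    The mean of [gam] over [[0, a]] is [a (c - a)^2], that is [(u - r)^2 (1 - u)] with [u = 1 - a]
    and [r = 1 - c]. *)
Lemma nonincreasing_quartic c : {in `]0, 1[, forall x, -1 <= h x} -> 0 < c -> c <= 1 ->
  2 * c ^+ 2 * m0 - 12 * c * m1 + 12 * m2 <= (1 - c) ^+ 2.
Proof.
move=> hN1 c0 c1.
have pY := primitive01B (primitive01_cst c) pX.
have pG : primitive01 (fun x => (x * x) * ((c - x) * (c - x)))
    (fun x => 2 * x * (c - x) * (c - 2 * x)).
  apply: primitive01_ext (primitive01M (primitive01M pX pX) (primitive01M pY pY)).
  by move=> x _ /=; ring.
have pg : primitive01 (fun x => 2 * x * (c - x) * (c - 2 * x))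
    (fun x => 2 * c ^+ 2 - 12 * c * x + 12 * x ^+ 2).
  apply: primitive01_ext (primitive01M (primitive01M (primitive01Z 2 pX) pY)
    (primitive01B (primitive01_cst c) (primitive01Z 2 pX))).
  by move=> x _ /=; ring.
have pM' : primitive01 (fun x => 2 * c ^+ 2 * cdf01 (fun x => x ^+ 0 * F x) x
    - 12 * c * cdf01 (fun x => x ^+ 1 * F x) x + 12 * cdf01 (fun x => x ^+ 2 * F x) x)
    (fun x => (2 * c ^+ 2 - 12 * c * x + 12 * x ^+ 2) * F x).
  apply: primitive01_ext (primitive01D (primitive01B
    (primitive01Z (2 * c ^+ 2) (pM 0)) (primitive01Z (12 * c) (pM 1))) (primitive01Z 12 (pM 2))).
  by move=> x _ /=; ring.
have := nonincreasing_moment_le (c := c) (d := c / 2) hN1 pG pg pM'.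
rewrite !cdf01_0 -/(moment01 0 F) -/(moment01 1 F) -/(moment01 2 F) => H.
suff : 2 * c ^+ 2 * m0 - 12 * c * m1 + 12 * m2 - (2 * c ^+ 2 * 0 - 12 * c * 0 + 12 * 0)
  <= 1 * 1 * ((c - 1) * (c - 1)) - 0 * 0 * ((c - 0) * (c - 0)) by lra.
apply: H; try lra.
- move=> x; rewrite in_itv/= => /andP[x0 xc].
  by rewrite !mulr_ge0//; lra.
- move=> x; rewrite in_itv/= => /andP[x0 xc].
  by rewrite mulr_ge0_le0 ?mulr_ge0//; lra.
- move=> x; rewrite in_itv/= => /andP[x0 xc].
  by rewrite mulr_le0 ?mulr_ge0_le0//; lra.
Qed.

(** Now [Gam = x (x - c)^2], with sign changes of [gam] at [c / 3] and [c]; the mean of [gam] over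
    [[0, a]] is [(a - c)^2 = (u - r)^2]. *)
Lemma nonincreasing_cubic c : {in `]0, 1[, forall x, -1 <= h x} -> 0 < c -> c <= 1 ->
  6 * m1 - 4 * c * m0 <= (1 - c) ^+ 2.
Proof.
move=> hN1 c0 c1.
have pY := primitive01B pX (primitive01_cst c).
have pG : primitive01 (fun x => x * ((x - c) * (x - c)))
    (fun x => (x - c) * (3 * x - c)).
  apply: primitive01_ext (primitive01M pX (primitive01M pY pY)).
  by move=> x _ /=; ring.
have pg : primitive01 (fun x => (x - c) * (3 * x - c)) (fun x => 6 * x - 4 * c).
  apply: primitive01_ext (primitive01M pY
    (primitive01B (primitive01Z 3 pX) (primitive01_cst c))).
  by move=> x _ /=; ring.
have pM' : primitive01 (fun x => 6 * cdf01 (fun x => x ^+ 1 * F x) x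
    - 4 * c * cdf01 (fun x => x ^+ 0 * F x) x) (fun x => (6 * x - 4 * c) * F x).
  apply: primitive01_ext (primitive01B (primitive01Z 6 (pM 1)) (primitive01Z (4 * c) (pM 0))).
  by move=> x _ /=; ring.
have := nonincreasing_moment_le (c := c) (d := c / 3) hN1 pG pg pM'.
rewrite !cdf01_0 -/(moment01 0 F) -/(moment01 1 F) => H.
suff : 6 * m1 - 4 * c * m0 - (6 * 0 - 4 * c * 0)
  <= 1 * ((1 - c) * (1 - c)) - 0 * ((0 - c) * (0 - c)) by lra.
apply: H; try lra.
- move=> x; rewrite in_itv/= => /andP[x0 xc].
  by rewrite mulr_le0//; lra.
- move=> x; rewrite in_itv/= => /andP[x0 xc].
  by rewrite mulr_le0_ge0//; lra.
- move=> x; rewrite in_itv/= => /andP[x0 xc].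
  by rewrite mulr_ge0//; lra.
Qed.

(* The moments of x |-> F (1 - x). *)
Local Notation l1 := (m0 - m1).
Local Notation l2 := (m0 - 2 * m1 + m2).

(** The quartic test function reflected by [x |-> 1 - x]. A primitive of the reflected [gam] is
    minus the reflected [Gam], whence the factor [-1]. *)
Lemma nondecreasing_quartic c : {in `]0, 1[, forall x, h x <= 1} -> 0 < c -> c <= 1 ->
  2 * c ^+ 2 * m0 - 12 * c * l1 + 12 * l2 <= (1 - c) ^+ 2.
Proof.
move=> hN1 c0 c1; pose b := 1 - c.
have pY := primitive01B (primitive01_cst 1) pX.
have pZ := primitive01B pX (primitive01_cst b).
have pG : primitive01 (fun x => -1 * (((1 - x) * (1 - x)) * ((x - b) * (x - b))))
    (fun x => 2 * (1 - x) * (x - b) * (2 * x - b - 1)).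
  apply: primitive01_ext (primitive01Z (-1) (primitive01M (primitive01M pY pY) (primitive01M pZ pZ))).
  by move=> x _ /=; ring.
have pg : primitive01 (fun x => 2 * (1 - x) * (x - b) * (2 * x - b - 1))
    (fun x => - (2 * c ^+ 2 - 12 * c * (1 - x) + 12 * (1 - x) ^+ 2)).
  apply: primitive01_ext (primitive01M (primitive01M (primitive01Z 2 pY) pZ)
    (primitive01B (primitive01B (primitive01Z 2 pX) (primitive01_cst b)) (primitive01_cst 1))).
  by move=> x _ /=; rewrite /b; ring.
have pM' : primitive01 (fun x => (12 * c - 12 - 2 * c ^+ 2) * cdf01 (fun x => x ^+ 0 * F x) x
    + (24 - 12 * c) * cdf01 (fun x => x ^+ 1 * F x) x - 12 * cdf01 (fun x => x ^+ 2 * F x) x)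
    (fun x => - (2 * c ^+ 2 - 12 * c * (1 - x) + 12 * (1 - x) ^+ 2) * F x).
  apply: primitive01_ext (primitive01B (primitive01D
    (primitive01Z (12 * c - 12 - 2 * c ^+ 2) (pM 0)) (primitive01Z (24 - 12 * c) (pM 1)))
    (primitive01Z 12 (pM 2))).
  by move=> x _ /=; ring.
have := nondecreasing_moment_le (c := b) (d := (1 + b) / 2) hN1 pG pg pM'.
rewrite !cdf01_0 -/(moment01 0 F) -/(moment01 1 F) -/(moment01 2 F) => H.
suff : (12 * c - 12 - 2 * c ^+ 2) * 0 + (24 - 12 * c) * 0 - 12 * 0 -
  ((12 * c - 12 - 2 * c ^+ 2) * m0 + (24 - 12 * c) * m1 - 12 * m2)
  <= -1 * ((1 - 1) * (1 - 1) * ((1 - b) * (1 - b))) -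
     -1 * ((1 - 0) * (1 - 0) * ((0 - b) * (0 - b))).
  by rewrite /b; lra.
apply: H; try (rewrite /b; lra).
- move=> x; rewrite in_itv/= => /andP[x0 xc].
  by rewrite mulr_le0 ?mulr_ge0_le0//; rewrite /b in xc *; lra.
- move=> x; rewrite in_itv/= => /andP[x0 xc].
  by rewrite mulr_ge0_le0 ?mulr_ge0//; rewrite /b in x0 xc *; lra.
- move=> x; rewrite in_itv/= => /andP[x0 xc].
  by rewrite !mulr_ge0//; rewrite /b in x0 *; lra.
Qed.

(** The cubic test function, reflected in the same way. *)
Lemma nondecreasing_cubic c : {in `]0, 1[, forall x, h x <= 1} -> 0 < c -> c <= 1 ->
  6 * l1 - 4 * c * m0 <= (1 - c) ^+ 2.
Proof.
move=> hN1 c0 c1; pose b := 1 - c.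
have pY := primitive01B (primitive01_cst 1) pX.
have pZ := primitive01B pX (primitive01_cst b).
have pG : primitive01 (fun x => -1 * ((1 - x) * ((x - b) * (x - b))))
    (fun x => (x - b) * (3 * x - b - 2)).
  apply: primitive01_ext (primitive01Z (-1) (primitive01M pY (primitive01M pZ pZ))).
  by move=> x _ /=; ring.
have pg : primitive01 (fun x => (x - b) * (3 * x - b - 2))
    (fun x => - (6 * (1 - x) - 4 * c)).
  apply: primitive01_ext (primitive01M pZ
    (primitive01B (primitive01B (primitive01Z 3 pX) (primitive01_cst b)) (primitive01_cst 2))).
  by move=> x _ /=; rewrite /b; ring.
have pM' : primitive01 (fun x => (4 * c - 6) * cdf01 (fun x => x ^+ 0 * F x) x
    + 6 * cdf01 (fun x => x ^+ 1 * F x) x)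
    (fun x => - (6 * (1 - x) - 4 * c) * F x).
  apply: primitive01_ext (primitive01D
    (primitive01Z (4 * c - 6) (pM 0)) (primitive01Z 6 (pM 1))).
  by move=> x _ /=; ring.
have := nondecreasing_moment_le (c := b) (d := (2 + b) / 3) hN1 pG pg pM'.
rewrite !cdf01_0 -/(moment01 0 F) -/(moment01 1 F) => H.
suff : (4 * c - 6) * 0 + 6 * 0 - ((4 * c - 6) * m0 + 6 * m1)
  <= -1 * ((1 - 1) * ((1 - b) * (1 - b))) - -1 * ((1 - 0) * ((0 - b) * (0 - b))).
  by rewrite /b; lra.
apply: H; try (rewrite /b; lra).
- move=> x; rewrite in_itv/= => /andP[x0 xc].
  by rewrite mulr_le0//; rewrite /b in xc *; lra.
- move=> x; rewrite in_itv/= => /andP[x0 xc].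
  by rewrite mulr_ge0_le0//; rewrite /b in x0 xc *; lra.
- move=> x; rewrite in_itv/= => /andP[x0 xc].
  by rewrite mulr_ge0//; rewrite /b in x0 *; lra.
Qed.

End one_function.

End moments.

(** * Comparison of the two Gini mean differences *)

Section comparison.
Context {R : realType}.

Lemma integrable01_one : integrable01 (cst 1 : R -> R).
Proof. by have [] := @primitive01_id R. Qed.

Lemma moment01_0 (u : R -> R) : moment01 0 u = cdf01 u 1.
Proof. by congr (cdf01 _ 1); apply/funext => x; rewrite expr0 mul1r. Qed.

Lemma primitive01_gini (U u : R -> R) : primitive01 U u ->
  primitive01 (cdf01 (fun x => 2 * U x * (1 - U x))) (fun x => 2 * U x * (1 - U x)).
Proof.
move=> pU; apply: primitive01_cdf01.
exact: primitive01_integrable (primitive01M (primitive01Z 2 pU)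
  (primitive01B (primitive01_cst 1) pU)).
Qed.

Lemma cdf01_bounds (u : R -> R) (x : R) : density01 u -> x \in `[0, 1] -> 0 <= cdf01 u x <= 1.
Proof.
move=> du; have [_ u0 _] := du; have pU := primitive01_cdf01 (density01_integrable du).
rewrite in_itv/= => /andP[x0 x1].
have u0' : {in `]0, 1[, forall t, 0 <= u t} by move=> t /subset_itv_oo_cc /u0.
apply/andP; split.
  rewrite -(cdf01_0 u); apply: (primitive01_le pU) => // t; rewrite in_itv/= => /andP[t0 tx].
  by apply: u0'; rewrite in_itv/= t0 (lt_le_trans tx).
rewrite -[leRHS](cdf01_1 du); apply: (primitive01_le pU) => // t; rewrite in_itv/= => /andP[xt t1].
by apply: u0'; rewrite in_itv/= t1 (le_lt_trans x0).
Qed.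

(** The polynomial inequality for [A <= 1 / 2]. The larger area [f] uses the quartic bound at
    [c = 1 - (f + g)], the smaller area [g] the quartic and cubic bounds at [c = 1 - 2 g]. *)
Lemma moment_arith (f a1 a2 g b1 b2 : R) : 0 <= g -> g <= f -> f + g <= 1 / 2 ->
  2 * (1 - (f + g)) ^+ 2 * f - 12 * (1 - (f + g)) * a1 + 12 * a2 <= (1 - (1 - (f + g))) ^+ 2 ->
  2 * (1 - 2 * g) ^+ 2 * g - 12 * (1 - 2 * g) * b1 + 12 * b2 <= (1 - (1 - 2 * g)) ^+ 2 ->
  6 * b1 - 4 * (1 - 2 * g) * g <= (1 - (1 - 2 * g)) ^+ 2 ->
  f / 3 - 2 * a1 + 2 * a2 + (g / 3 - 2 * b1 + 2 * b2) <=
  (f + g) * ((f - 2 * a1) + (g - 2 * b1) - 2 / 3 * (f ^+ 2 + g ^+ 2) + f * g / 3).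
Proof.
move=> g0 gf fg H1 H2 H3.
(* All moments cancel in [H1 / 6 + H2 / 6 + H4 / 3]: the factor [f - g] absorbs the mismatch of the
   two values of [c] in the terms in [b1]. The remaining slack is [H5 / 3 + H6 / 6]. *)
have H4 : 0 <= (f - g) * ((1 - (1 - 2 * g)) ^+ 2 - (6 * b1 - 4 * (1 - 2 * g) * g)).
  by rewrite mulr_ge0// subr_ge0.
have H5 : 0 <= g ^+ 2 * (3 * f - g) by rewrite mulr_ge0 ?sqr_ge0//; lra.
have H6 : 0 <= (f - g) ^+ 2 * (1 - 2 * (f + g)) by rewrite mulr_ge0 ?sqr_ge0//; lra.
lra.
Qed.

(** * The gaps [F] and [G] between the two distribution functions and the identity *)

Variables phi psi : R -> R.
Hypotheses (dphi : density01 phi) (dpsi : density01 psi).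
Hypotheses (mphi : nonincreasing01 phi) (mpsi : nondecreasing01 psi).
Hypothesis A_gt0 : 0 < gap_area phi psi.
Local Notation A := (gap_area phi psi).
Local Notation Phi := (cdf01 phi).
Local Notation Psi := (cdf01 psi).
Local Notation h := (fun x => phi x - 1).
Local Notation k := (fun x => 1 - psi x).
Local Notation F := (cdf01 h).
Local Notation G := (cdf01 k).
Local Notation f := (cdf01 F 1).
Local Notation g := (cdf01 G 1).
Local Notation f1 := (moment01 1 F).
Local Notation f2 := (moment01 2 F).
Local Notation g1 := (moment01 1 G).
Local Notation g2 := (moment01 2 G).
Local Notation q := (avg_density phi psi).
Local Notation p := (gap_density phi psi).
Local Notation Q := (cdf01 q).
Local Notation P := (cdf01 p).

Let iphi := density01_integrable dphi.
Let ipsi := density01_integrable dpsi.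

Lemma integrable_left_gap : integrable01 h.
Proof. exact: integrable01B iphi integrable01_one. Qed.

Lemma integrable_right_gap : integrable01 k.
Proof. exact: integrable01B integrable01_one ipsi. Qed.

Let ih := integrable_left_gap.
Let ik := integrable_right_gap.

Lemma nonincreasing_left_gap : nonincreasing01 h.
Proof. by move=> s t s01 t01 st; rewrite lerD2r mphi. Qed.

Lemma nonincreasing_right_gap : nonincreasing01 k.
Proof. by move=> s t s01 t01 st; rewrite lerD2l lerN2 mpsi. Qed.

Let mh := nonincreasing_left_gap.
Let mk := nonincreasing_right_gap.

Lemma left_gapE x : x \in `[0, 1] -> F x = Phi x - x.
Proof.
rewrite in_itv/= => /andP[x0 x1].
by rewrite (cdf01B iphi integrable01_one)// cdf01_cst// mul1r.
Qed.

Lemma right_gapE x : x \in `[0, 1] -> G x = x - Psi x.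
Proof.
rewrite in_itv/= => /andP[x0 x1].
by rewrite (cdf01B integrable01_one ipsi)// cdf01_cst// mul1r.
Qed.

Lemma cdf01_avg x : x \in `[0, 1] -> Q x = (Phi x + Psi x) / 2.
Proof.
rewrite in_itv/= => /andP[x0 x1].
rewrite (_ : avg_density phi psi = fun x => 2^-1 * (phi x + psi x)); last first.
  by apply/funext => t; rewrite /avg_density mulrC.
by rewrite (cdf01Z _ (integrable01D iphi ipsi) x1) (cdf01D iphi ipsi x1) mulrC.
Qed.

Lemma left_gap1 : F 1 = 0.
Proof. by rewrite left_gapE ?cdf01_1 ?subrr// in_itv/= ler01 lexx. Qed.

Lemma right_gap1 : G 1 = 0.
Proof. by rewrite right_gapE ?cdf01_1 ?subrr// in_itv/= ler01 lexx. Qed.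

Lemma left_slope_ge : {in `]0, 1[, forall x, -1 <= phi x - 1}.
Proof.
move=> x x01; have [_ phi0 _] := dphi; rewrite lerBrDr addNr phi0//.
exact: subset_itv_oo_cc.
Qed.

Lemma right_slope_le : {in `]0, 1[, forall x, 1 - psi x <= 1}.
Proof.
move=> x x01; have [_ psi0 _] := dpsi; rewrite gerBl psi0//.
exact: subset_itv_oo_cc.
Qed.

Let pX := @primitive01_id R.
Let pF := primitive01_cdf01 ih.
Let pG := primitive01_cdf01 ik.
Let pMF n := primitive01_moment n pF.
Let pMG n := primitive01_moment n pG.

Lemma gap_areaE : A = f + g.
Proof.
rewrite /gap_area -/(cdf01 (cdf_gap phi psi) 1) -cdf01D//.
- by apply: eq_cdf01 => // x x01; rewrite left_gapE// right_gapE// /cdf_gap; ring.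
- exact: primitive01_integrable pF.
- exact: primitive01_integrable pG.
Qed.

Let pQ := primitive01_cdf01 (density01_integrable (avg_density01 dphi dpsi)).
Let pP := primitive01_cdf01 (density01_integrable (gap_density01 dphi dpsi mphi mpsi A_gt0)).

(** As [Q = x + (F - G) / 2], the integrand equals [2 x (1 - x) + (1 - 2 x) (F - G) - (F^2 + G^2) /
    2 + F G]. Only the quadratic terms are estimated. *)
Lemma gini_avg_ge_moments :
  1 / 3 + (f - 2 * f1) - (g - 2 * g1) - 2 / 3 * (f ^+ 2 + g ^+ 2) + f * g / 3 <=
  cdf01 (fun x => 2 * Q x * (1 - Q x)) 1.
Proof.
have HF := concave_sqr_le ih mh left_gap1; have HG := concave_sqr_le ik mk right_gap1.
have HFG := concave_prod_ge ih ik mh mk left_gap1 right_gap1.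
have pFF := primitive01_cdf01 (primitive01_integrable (primitive01M pF pF)).
have pGG := primitive01_cdf01 (primitive01_integrable (primitive01M pG pG)).
have pFG := primitive01_cdf01 (primitive01_integrable (primitive01M pF pG)).
have pX2 := primitive01M pX pX.
have := primitive01B (primitive01_gini pQ) (primitive01D (primitive01D (primitive01D
  (primitive01B pX2 (primitive01Z (2 / 3) (primitive01M pX2 pX)))
  (primitive01B (primitive01B (pMF 0) (primitive01Z 2 (pMF 1)))
    (primitive01B (pMG 0) (primitive01Z 2 (pMG 1)))))
  (primitive01Z (- (1 / 2)) (primitive01D pFF pGG))) pFG).
move=> /primitive01_le/(_ (lexx 0) ler01 (lexx 1)).
rewrite /= !cdf01_0 -!/(moment01 _ _) !moment01_0 => H.
have /H : {in `]0, 1[, forall x : R, 0 <= 2 * Q x * (1 - Q x) -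
   (1 * x + x * 1 - 2 / 3 * ((1 * x + x * 1) * x + x * x * 1) +
    (x ^+ 0 * F x - 2 * (x ^+ 1 * F x) - (x ^+ 0 * G x - 2 * (x ^+ 1 * G x))) +
    - (1 / 2) * (F x * F x + G x * G x) + F x * G x)}.
  move=> x /subset_itv_oo_cc x01; rewrite cdf01_avg// left_gapE// right_gapE//.
  by move: (Phi x) (Psi x) => a b; rewrite le_eqVlt; apply/orP; left; apply/eqP; field.
move: HF HG HFG; move: (cdf01 _ 1) f f1 => D a a1; move: (cdf01 _ 1) g g1 => FF b b1.
move: (cdf01 _ 1) (cdf01 _ 1) => GG FG; clear H pFF pGG pFG pX2; lra.
Qed.

(** Drop the square in [2 P (1 - P) = 2 x^2 + 2 (1 - 2 x) P - 2 (P - x)^2]. *)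
Lemma gini_gap_le_moments :
  A * cdf01 (fun x => 2 * P x * (1 - P x)) 1 <=
  A / 3 + (f / 3 - 2 * f1 + 2 * f2) + (g / 3 - 2 * g1 + 2 * g2).
Proof.
have pX2 := primitive01M pX pX.
(* [(x - x^2) P] vanishes at both ends, so the integral of [(1 - 2 x) P] is minus that of
   [(x - x^2) p], where [p = (F + G) / A]. *)
have := primitive01B (primitive01B (primitive01D (primitive01Z (2 / 3) (primitive01M pX2 pX))
  (primitive01Z 2 (primitive01M (primitive01B pX pX2) pP)))
  (primitive01Z (2 / A) (primitive01B (primitive01D (pMF 1) (pMG 1)) (primitive01D (pMF 2) (pMG 2)))))
  (primitive01_gini pP).
move=> /primitive01_le/(_ (lexx 0) ler01 (lexx 1)).
rewrite /= !cdf01_0 -!/(moment01 _ _) => H.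
have {}/H H : {in `]0, 1[, forall x : R, 0 <=
   2 / 3 * ((1 * x + x * 1) * x + x * x * 1) +
    2 * ((1 - (1 * x + x * 1)) * P x + (x - x * x) * gap_density phi psi x) -
    2 / A * (x ^+ 1 * F x + x ^+ 1 * G x - (x ^+ 2 * F x + x ^+ 2 * G x)) -
    2 * P x * (1 - P x)}.
  move=> x /subset_itv_oo_cc x01; rewrite left_gapE// right_gapE//
    [p x](erefl : p x = (Phi x - Psi x) * A^-1).
  rewrite (_ : _ - _ = 2 * (P x - x) ^+ 2); first by rewrite mulr_ge0// sqr_ge0.
  by move: (Phi x) (Psi x) (P x) A^-1 => a b c d; field.
have {}H : cdf01 (fun x => 2 * P x * (1 - P x)) 1 <= 2 / 3 - 2 / A * (f1 + g1 - (f2 + g2)).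
  move: H; move: (cdf01 _ 1) (P 1) f1 f2 g1 g2 (2 / A) => D p1 a1 a2 b1 b2 e.
  by clear pX2; lra.
apply: (le_trans (ler_wpM2l (ltW A_gt0) H)).
have -> : A * (2 / 3 - 2 / A * (f1 + g1 - (f2 + g2))) =
    A * 2 / 3 - 2 * (f1 + g1 - (f2 + g2)).
  by have := A_gt0; move: A f1 f2 g1 g2 => a a1 a2 b1 b2 a0; field; rewrite gt_eqF.
rewrite gap_areaE; move: f f1 f2 g g1 g2 => a a1 a2 b b1 b2; clear H pX2; lra.
Qed.

Lemma gini_avg_ge_third : 1 / 2 <= A -> 1 / 3 <= cdf01 (fun x => 2 * Q x * (1 - Q x)) 1.
Proof.
move=> A2.
pose w x := phi x - psi x.
have iw : integrable01 w by exact: integrable01B.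
have mw : nonincreasing01 w.
  by move=> s t s01 t01 st; apply: lerB; [exact: mphi|exact: mpsi].
have wE (x : R) : x \in `[0, 1] -> cdf01 w x = Phi x - Psi x.
  by rewrite in_itv/= => /andP[x0 x1]; rewrite cdf01B.
have w1 : cdf01 w 1 = 0 by rewrite wE ?cdf01_1 ?subrr// in_itv/= ler01 lexx.
have AE : cdf01 (cdf01 w) 1 = A by apply: eq_cdf01 => // x x01; rewrite wE.
have := concave_sqr_le iw mw w1; rewrite AE => HW.
have pw := primitive01_cdf01 iw.
have pW := primitive01_cdf01 (primitive01_integrable pw).
have pWW := primitive01_cdf01 (primitive01_integrable (primitive01M pw pw)).
have := primitive01_le (primitive01D (primitive01B (primitive01_gini pQ) pW)
  (primitive01Z (1 / 2) pWW)) (lexx 0) ler01 (lexx 1).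
rewrite /= !cdf01_0 AE => H.
have {}/H H : {in `]0, 1[, forall x : R, 0 <= 2 * Q x * (1 - Q x) - cdf01 w x
    + 1 / 2 * (cdf01 w x * cdf01 w x)}.
  move=> x /subset_itv_oo_cc x01; rewrite cdf01_avg// wE//.
  have /andP[_ H1] := cdf01_bounds dphi x01; have /andP[H2 _] := cdf01_bounds dpsi x01.
  (* The derivative in question equals [2 Psi (1 - Phi)]. *)
  have : 0 <= Psi x * (1 - Phi x) by rewrite mulr_ge0// subr_ge0.
  by move: (Phi x) (Psi x) => a b; lra.
have A1 : A <= 1.
  have := primitive01_le (primitive01B pX pW) (lexx 0) ler01 (lexx 1).
  rewrite /= cdf01_0 AE subr0 subr_ge0; apply => x /subset_itv_oo_cc x01; rewrite wE// subr_ge0.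
  have /andP[_ H1] := cdf01_bounds dphi x01; have /andP[H2 _] := cdf01_bounds dpsi x01.
  by move: H1 H2 => /=; move: (Phi x) (Psi x) => a b; lra.
(* [A - 2/3 A^2 - 1/3 = (1 - A) (2 A - 1) / 3]. *)
have : 0 <= (1 - A) * (2 * A - 1) by rewrite mulr_ge0//; move: A A1 A2 => a; lra.
move: H HW; move: (cdf01 _ 1) (cdf01 _ 1) A => a b c; lra.
Qed.

Let quarticF c := nonincreasing_quartic ih mh left_gap1 left_slope_ge (c := c).
Let cubicF c := nonincreasing_cubic ih mh left_gap1 left_slope_ge (c := c).
Let quarticG c := nondecreasing_quartic ik mk right_gap1 right_slope_le (c := c).
Let cubicG c := nondecreasing_cubic ik mk right_gap1 right_slope_le (c := c).

(** The quartic bounds at [c = 1], that is [r = 0], divided by 6. With [gini_gap_le_moments] they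
    bound the Gini mean difference of [p] by [1 / 3]. *)
Lemma gap_moments_le0 : (f / 3 - 2 * f1 + 2 * f2) + (g / 3 - 2 * g1 + 2 * g2) <= 0.
Proof.
have := quarticF ltr01 (lexx 1); have := quarticG ltr01 (lexx 1).
rewrite !moment01_0; move: f f1 f2 g g1 g2 => a a1 a2 b b1 b2; lra.
Qed.

Lemma gap_moments_le : f + g <= 1 / 2 ->
  (f / 3 - 2 * f1 + 2 * f2) + (g / 3 - 2 * g1 + 2 * g2) <=
  (f + g) * ((f - 2 * f1) - (g - 2 * g1) - 2 / 3 * (f ^+ 2 + g ^+ 2) + f * g / 3).
Proof.
have := concave_integral_ge0 ih mh left_gap1; have := concave_integral_ge0 ik mk right_gap1.
(* Here [c = 1 - r]; the choices of [r] are prepared for both orders of [f] and [g]. *)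
have := @quarticF (1 - (f + g)); have := @quarticF (1 - 2 * f); have := @cubicF (1 - 2 * f).
have := @quarticG (1 - (g + f)); have := @quarticG (1 - 2 * g); have := @cubicG (1 - 2 * g).
rewrite !moment01_0; move: f f1 f2 g g1 g2 => a a1 a2 b b1 b2.
move=> G3 G4 G4' F3 F4 F4' b0 a0 ab2.
have [ba|/ltW ab] := leP b a.
  (* [G] enters through the moments of [x |-> G (1 - x)]: this preserves the weight
     [1/3 - 2 x (1 - x)] and changes the sign of [1 - 2 x]. *)
  have := @moment_arith a a1 a2 b (b - b1) (b - 2 * b1 + b2) b0 ba ab2.
  move=> /(_ (F4' _ _) (G4 _ _) (G3 _ _)) H.
  suff : a / 3 - 2 * a1 + 2 * a2 + (b / 3 - 2 * (b - b1) + 2 * (b - 2 * b1 + b2)) <=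
    (a + b) * (a - 2 * a1 + (b - 2 * (b - b1)) - 2 / 3 * (a ^+ 2 + b ^+ 2) + a * b / 3) by lra.
  by apply: H; lra.
have ba2 : b + a <= 1 / 2 by rewrite addrC.
have := @moment_arith b (b - b1) (b - 2 * b1 + b2) a a1 a2 a0 ab ba2.
move=> /(_ (G4' _ _) (F4 _ _) (F3 _ _)) H.
suff : b / 3 - 2 * (b - b1) + 2 * (b - 2 * b1 + b2) + (a / 3 - 2 * a1 + 2 * a2) <=
  (b + a) * (b - 2 * (b - b1) + (a - 2 * a1) - 2 / 3 * (b ^+ 2 + a ^+ 2) + b * a / 3) by lra.
by apply: H; lra.
Qed.

Lemma gini_gap_le_avg : cdf01 (fun x => 2 * P x * (1 - P x)) 1 <=
  cdf01 (fun x => 2 * Q x * (1 - Q x)) 1.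
Proof.
rewrite -(ler_pM2l A_gt0); apply: (le_trans gini_gap_le_moments).
have [A2|/ltW A2] := leP (1 / 2) A.
  apply: le_trans (ler_wpM2l (ltW A_gt0) (gini_avg_ge_third A2)).
  by rewrite mulrA mulr1 -addrA gerDl gap_moments_le0.
apply: le_trans (ler_wpM2l (ltW A_gt0) gini_avg_ge_moments).
move: A2; rewrite gap_areaE => /gap_moments_le.
move: f f1 f2 g g1 g2 => a a1 a2 b b1 b2; lra.
Qed.

End comparison.

Unset Implicit Arguments.

Theorem theorem2p1 (R : realType) (phi psi : R -> R)
    (dphi : density01 phi) (dpsi : density01 psi)
    (mphi : nonincreasing01 phi) (mpsi : nondecreasing01 psi)
    (A_gt0 : 0 < gap_area phi psi) :
  (gini (density_prob (avg_density01 dphi dpsi)) >=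
   gini (density_prob (gap_density01 dphi dpsi mphi mpsi A_gt0)))%E.
Proof. by rewrite !gini_density_prob lee_fin; exact: gini_gap_le_avg. Qed.
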